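(* Let $n\ge 3$ and let $(K_n)_\phi$ be a signed complete graph on $n$ vertices with sink $q$ that is switching equivalent to $-K_n$. Then $$\mathcal{K}((K_n)_\phi)\cong\mathbb{Z}_{n-2}^{\,n-3}\oplus\mathbb{Z}_{(n-2)(2n-3)}.$$
   Context: A signed graph $G_\phi$ is a finite simple graph $G=(V,E)$ with a sign function $\phi:E\to\{+,-\}$. Switching a vertex $v$ means reversing the sign of every edge incident to $v$; two signed graphs on the same underlying graph are switching equivalent if one is obtained from the other by a finite sequence of vertex switchings. $-K_n$ denotes the complete graph on $n$ vertices, with sink $q$, signed so that every edge not incident to $q$ is negative (edges incident to $q$ may have any sign). For a signed graph with $N$ nonsink vertices $v_1,\dots,v_N$ and sink $q$, the reduced signed Laplacian $L_{G_\phi}$ is the $N\times N$ matrix with diagonal entries $\deg_G(v_i)$ (counting edges to $q$) and, for $i\neq j$, $(i,j)$ entry $-1$ if $v_iv_j$ is a positive edge, $+1$ if it is a negative edge, $0$ if it is not an edge. The critical group is $\mathcal{K}(G_\phi)=\mathbb{Z}^N/\mathrm{im}\,L_{G_\phi}$ (for $K_n$, $N=n-1$). $\mathbb{Z}_k$ denotes $\mathbb{Z}/k\mathbb{Z}$. *)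

(* Defs.v *)
From HB Require Import structures.
From mathcomp Require Import all_boot all_order all_algebra.
From mathcomp Require Import boolp.
Set Implicit Arguments.
Unset Strict Implicit.
Unset Printing Implicit Defensive.
Import GRing.Theory.
Local Open Scope ring_scope.

(** * Signed graphs *)

Record graph (V : finType) := Graph {
  edges : {set {set V}};
  edges_card2 : forall e, e \in edges -> #|e| = 2%N
}.

Lemma complete_card2 (V : finType) (e : {set V}) :
  e \in [set e' : {set V} | #|e'| == 2%N] -> #|e| = 2%N.
Proof. by rewrite inE => /eqP. Qed.

Definition complete_graph (V : finType) : graph V :=
  Graph (@complete_card2 V).

Section SignedGraphs.
Variables (V : finType) (G : graph V).

Definition edge : finType := {e : {set V} | e \in edges G}.

Variant sign := Pos | Neg.

Definition flip (s : sign) : sign := if s is Pos then Neg else Pos.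

Definition signing := {ffun edge -> sign}.

Definition switch (phi : signing) (v : V) : signing :=
  [ffun e : edge => if v \in val e then flip (phi e) else phi e].

Definition switching_equivalent (phi psi : signing) : Prop :=
  exists s : seq V, foldl switch phi s = psi.

Definition degree (x : V) : nat := #|[set e in edges G | x \in e]|.

Definition signed_adj (phi : signing) (x y : V) : int :=
  match insub [set x; y] : option edge with
  | Some e => if phi e is Pos then -1 else 1
  | None => 0
  end.

(* The nonsink vertices v_1, ..., v_N are enumerated by enum_val. *)
Definition reduced_laplacian (q : V) (phi : signing) : 'M[int]_#|[set~ q]| :=
  \matrix_(i, j)
    if i == j then (degree (enum_val i))%:Z
    else signed_adj phi (enum_val i) (enum_val j).

End SignedGraphs.

(* -K_n is a family of signings: the edges at the sink q are unconstrained. *)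
Definition negative_complete (V : finType) (q : V)
    (psi : signing (complete_graph V)) : Prop :=
  forall e : edge (complete_graph V), q \notin val e -> psi e = Neg.

(** * Critical groups *)

Section Cokernel.
Variables (m n : nat) (L : 'M[int]_(m, n)).

Definition im_mx : {pred 'cV[int]_m} :=
  fun v => `[< exists x : 'cV[int]_n, v = L *m x >].

Lemma im_mx_zmod_closed : zmod_closed im_mx.
Proof.
split=> [|u v /asboolP[x ->] /asboolP[y ->]]; apply/asboolP.
  by exists 0; rewrite mulmx0.
by exists (x - y); rewrite mulmxBr.
Qed.

HB.instance Definition _ :=
  GRing.isZmodClosed.Build 'cV[int]_m im_mx im_mx_zmod_closed.

Definition coker_mx : zmodType := Quotient.quot im_mx.

End Cokernel.

Definition critical_group (V : finType) (G : graph V) (q : V)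
    (phi : signing G) : zmodType :=
  coker_mx (reduced_laplacian q phi).

(* The library's 'Z_k is Z/2Z when k = 1, so Z/kZ is taken as a quotient of
   int, which is trivial for k = 1. *)
Definition Zmod (k : nat) : zmodType :=
  Quotient.quot (dvdz k%:Z : {pred int}).

Definition isomorphic (A B : zmodType) : Prop :=
  exists f : {additive A -> B}, bijective f.

(* Main.v *)
Require Import Defs.
From mathcomp Require Import all_boot all_order all_algebra.
From HB Require Import structures.
From mathcomp Require Import boolp zify ring.

(** Switching a nonsink vertex multiplies one row and the same column of the
reduced Laplacian by -1, and switching the sink leaves the matrix unchanged.
Both are conjugations by a diagonal involution over the integers, so they do
not change the cokernel up to isomorphism
([critical_group_switching_equivalent]), and the signing may be taken to be
-K_n itself.

Its reduced Laplacian is m I + J, where m = n - 2, J is the all-ones matrix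
and the size is m + 1.  Write e_a, e_b and e_i, for m - 1 indices i, for the
standard basis and s for the sum of its vectors.  The relations of the
cokernel are m e_j = - s for all j, so the differences d_j = e_j - e_a satisfy
m d_j = 0; and m e_a + s = 0 reads
  d_b = - (2 m + 1) e_a - sum_i d_i.
Hence d_b is redundant and its relation m d_b = 0 becomes m (2 m + 1) e_a = 0:
the cokernel is the direct sum of the cyclic groups of order m generated by
the d_i and of the one of order m (2 m + 1) generated by e_a.  Expanding
x = sum_j x_j e_j in these generators gives the isomorphism
  x |-> ((x_i - x_b mod m)_i, sum_j x_j - (2 m + 1) x_b mod m (2 m + 1)).
[coker_uniform_mx] proves that this map is onto and has the right kernel,
using the description of the image of m I + J by congruences given in
[mem_im_uniform_mx]. *)

Set Implicit Arguments.
Unset Strict Implicit.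
Unset Printing Implicit Defensive.
Import GRing.Theory.
Local Open Scope ring_scope.
Local Open Scope quotient_scope.

(** * Isomorphisms of cokernels *)

Lemma isomorphic_trans (A B C : zmodType) :
  isomorphic A B -> isomorphic B C -> isomorphic A C.
Proof.
case=> f f_bij [g g_bij].
have gf_bij : bijective (g \o f) by exact: bij_comp.
by exists (g \o f).
Qed.

Local Notation im_quot L := (Quotient.quot (im_mx L)).

(** This is the first isomorphism theorem.  The map [g] has to be surjective,
and a section of it gives an explicit inverse of the induced map. *)
Lemma coker_mx_isomorphic m n (L : 'M[int]_(m, n)) (B : zmodType)
    (g : {additive 'cV[int]_m -> B}) (s : B -> 'cV[int]_m) :
  cancel s g -> (forall x, (g x == 0) = (x \in im_mx L)) ->
  isomorphic (coker_mx L) B.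
Proof.
move=> sK ker_g; pose f (u : coker_mx L) := g (repr (u : im_quot L)).
have fE x : f (\pi_(im_quot L) x) = g x.
  apply/eqP; rewrite /f -subr_eq0 -raddfB ker_g Quotient.idealrBE.
  by rewrite reprK.
have f_add : zmod_morphism f.
  move=> u v; rewrite -[u in LHS](reprK (u : im_quot L)).
  rewrite -[v in LHS](reprK (v : im_quot L)).
  by rewrite -[_ - _]raddfB fE raddfB.
pose F := GRing.isZmodMorphism.Build _ _ f f_add.
pose fA : {additive coker_mx L -> B} := HB.pack f F.
exists fA; exists (fun b => \pi_(im_quot L) (s b)) => [u|b].
  rewrite -[RHS](reprK (u : im_quot L)).
  by apply/eqP; rewrite -Quotient.idealrBE -ker_g raddfB sK subr_eq0.
by rewrite /= fE sK.
Qed.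

Lemma mem_im_mx m n (L : 'M[int]_(m, n)) x :
  reflect (exists y, x = L *m y) (x \in im_mx L).
Proof. exact: asboolP. Qed.

(** A unimodular [Q] preserves the image, and a unimodular [P] carries the
image of [L *m Q] onto that of the product. *)
Lemma coker_mx_equiv m n (P : 'M[int]_m) (L : 'M[int]_(m, n)) (Q : 'M[int]_n) :
  P \in unitmx -> Q \in unitmx ->
  isomorphic (coker_mx (P *m L *m Q)) (coker_mx L).
Proof.
move=> uP uQ.
pose g (x : 'cV[int]_m) : coker_mx L :=
  \pi_(im_quot L) (invmx P *m x).
have g_add : zmod_morphism g by move=> x y; rewrite /g mulmxBr; apply: raddfB.
pose gA : {additive _ -> _} := HB.pack g (GRing.isZmodMorphism.Build _ _ g g_add).
apply: (@coker_mx_isomorphic _ _ _ _ gA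
  (fun u => P *m repr (u : im_quot L))) => [u|x].
  by rewrite /= /g mulKmx ?reprK.
rewrite /= /g -(raddf0 (\pi_(im_quot L))) -Quotient.idealrBE subr0.
apply/mem_im_mx/mem_im_mx => -[y xE].
  exists (invmx Q *m y).
  by rewrite -!mulmxA (mulmxA Q) mulmxV // mul1mx -xE mulKVmx.
by exists (Q *m y); rewrite xE -!mulmxA mulKmx.
Qed.

(** * Invariance under switching *)

Section Switching.
Variables (V : finType) (G : graph V).
Implicit Types phi psi : signing G.

Definition switch_sign (v x : V) : int := if x == v then -1 else 1.

Lemma switch_sign_sqr v x : switch_sign v x * switch_sign v x = 1.
Proof. by rewrite /switch_sign; case: ifP. Qed.

(** An edge changes sign when exactly one of its ends is [v]; the hypothesis
excludes the pair at which both factors are -1. *)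
Lemma signed_adj_switch phi v x y : x != y ->
  signed_adj (switch phi v) x y =
  switch_sign v x * signed_adj phi x y * switch_sign v y.
Proof.
move=> xy; rewrite /signed_adj; case: insubP => [e _ eE|]; last by rewrite mulr0 mul0r.
rewrite ffunE eE !inE !(eq_sym v) /switch_sign.
case: (eqVneq x v) xy => [->|_] xy; last by case: eqVneq => _; case: (phi e).
by case: eqVneq xy => // _ _; case: (phi e).
Qed.

(** The degrees on the diagonal are unaffected since the signs square to 1.
When [v] is the sink, [D] is the identity. *)
Lemma reduced_laplacian_switch q phi v :
  let D := diag_mx (\row_i switch_sign v (enum_val i)) in
  reduced_laplacian q (switch phi v) = D *m reduced_laplacian q phi *m D.
Proof.
rewrite /=; apply/matrixP => i j; rewrite mul_diag_mx mul_mx_diag !mxE.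
case: eqP => [->|/eqP ij]; first by rewrite mulrAC switch_sign_sqr mul1r.
by rewrite signed_adj_switch // (inj_eq enum_val_inj).
Qed.

Lemma critical_group_switch q phi v :
  isomorphic (critical_group q phi) (critical_group q (switch phi v)).
Proof.
have := reduced_laplacian_switch q phi v; set D := diag_mx _ => /= LE.
have DD : D *m D = 1%:M.
  apply/matrixP => i j; rewrite mul_diag_mx !mxE.
  by case: eqP => [->|_]; rewrite ?mulr0n ?mulr0 // !mulr1n switch_sign_sqr.
have [uD _] := mulmx1_unit DD.
have {}LE : reduced_laplacian q phi =
    D *m reduced_laplacian q (switch phi v) *m D.
  by rewrite LE !mulmxA DD mul1mx -mulmxA DD mulmx1.
by rewrite /critical_group LE; apply: coker_mx_equiv.
Qed.

Lemma critical_group_switching_equivalent q phi psi :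
  switching_equivalent phi psi ->
  isomorphic (critical_group q phi) (critical_group q psi).
Proof.
case=> s <-{psi}; elim: s phi => [|v s IHs] phi /=.
  by exists idfun; exists idfun.
exact: isomorphic_trans (critical_group_switch q phi v) (IHs _).
Qed.
End Switching.

(** * The reduced Laplacian of -K_n *)

Lemma degree_complete (V : finType) (x : V) :
  degree (complete_graph V) x = #|V|.-1.
Proof.
rewrite /degree -(cardsC1 x) -(card_in_imset (f := fun y => [set x; y])).
  apply: eq_card => e; rewrite !inE; apply/andP/imsetP => [[]|[y]].
    move=> /cards2P[a [b [ab ->]]]; rewrite !inE => /orP[] /eqP ->.
      by exists b => //; rewrite !inE eq_sym.
    by exists a; rewrite ?inE // setUC.
  by rewrite !inE => yx ->; rewrite !inE eqxx cards2 (eq_sym x) yx.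
move=> y z; rewrite !inE => yx zx /setP/(_ y).
by rewrite !inE eqxx orbT (negPf yx) => /esym/eqP.
Qed.

(** The signs at the sink are unconstrained, but they only occur in the row
and column that are deleted. *)
Lemma reduced_laplacian_negative_complete (V : finType) (q : V)
    (psi : signing (complete_graph V)) :
  negative_complete q psi ->
  reduced_laplacian q psi =
    \matrix_(i, j) if i == j then (#|V|.-1)%:Z else 1.
Proof.
move=> psiN; apply/matrixP => i j; rewrite !mxE degree_complete.
case: eqP => // /eqP ij; rewrite /signed_adj.
have [iq jq] : enum_val i != q /\ enum_val j != q.
  by have := (enum_valP i, enum_valP j); rewrite !inE => -[].
case: insubP => [e _ eE|].
  by rewrite psiN // eE !inE negb_or !(eq_sym q) iq.
by rewrite !inE cards2 (inj_eq enum_val_inj) ij.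
Qed.

(** * The cokernel of m I + J *)

Section UniformMatrix.
Variable k : nat.
Notation m := k.+1.
Let L : 'M[int]_(k.+2) := \matrix_(i, j) if i == j then k.+2%:Z else 1.

(** If x = (m I + J) y, then s is the sum of the entries of y: each x_i is
m y_i + s, and summing over the m + 1 indices gives (2 m + 1) s.  Conversely s
determines y_i as (x_i - s) / m, and the first condition says that these
quotients add up to s. *)
Lemma mem_im_uniform_mx (x : 'cV[int]_k.+2) :
  (x \in im_mx L) <->
  exists2 s : int, \sum_i x i 0 = (k.*2.+3)%:Z * s
    & forall i, (x i 0%R = s %[mod m])%Z.
Proof.
have LE (y : 'cV[int]_k.+2) i : (L *m y) i 0 = m%:Z * y i 0 + \sum_j y j 0.
  rewrite mxE (bigD1 i) //= [in RHS](bigD1 i) //= mxE eqxx.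
  rewrite (eq_bigr (fun j => y j 0)) => [|j ji]; last first.
    by rewrite mxE eq_sym (negPf ji) mul1r.
  ring.
have coefE : (k.*2.+3)%:Z = m%:Z + k.+2%:Z by lia.
split=> [/mem_im_mx[y ->]|[s sumx xs]].
  exists (\sum_j y j 0) => [|i]; last by rewrite LE mulrC modzMDl.
  under eq_bigr do rewrite LE.
  rewrite big_split /= -mulr_sumr sumr_const card_ord -mulr_natl natz.
  by rewrite coefE mulrDl.
have /fin_all_exists[t tE] i : exists t, x i 0 = m%:Z * t + s.
  have /eqP := xs i; rewrite eqz_mod_dvd => /dvdzP[t tE].
  by exists t; rewrite mulrC -tE subrK.
have sumt : \sum_i t i = s.
  move: sumx; under eq_bigr do rewrite tE.
  rewrite big_split /= -mulr_sumr sumr_const card_ord -mulr_natl natz.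
  by rewrite coefE mulrDl => /addIr/mulfI; apply.
apply/mem_im_mx; exists (\col_i t i); apply/matrixP => i j.
rewrite (ord1 j) LE tE mxE; congr (_ + _); rewrite -sumt.
by apply: eq_bigr => l _; rewrite mxE.
Qed.

Lemma coker_uniform_mx :
  isomorphic (coker_mx L) ({ffun 'I_k -> Zmod m} * Zmod (m * k.*2.+3))%type.
Proof.
pose piZ d (x : int) : Zmod d := \pi_(Quotient.quot (dvdz d%:Z : {pred int})) x.
pose reprZ d (u : Zmod d) : int := repr (u : Quotient.quot (dvdz d%:Z : {pred int})).
have piZK d : cancel (@reprZ d) (piZ d) by move=> u; apply: reprK.
have piZB d : {morph piZ d : x y / x - y} by move=> x y; apply: raddfB.
have piZ_eq0 d x : (piZ d x == 0) = (d%:Z %| x)%Z.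
  rewrite -(raddf0 (\pi_(Quotient.quot (dvdz d%:Z : {pred int})))) /piZ.
  by rewrite -Quotient.idealrBE subr0.
(* The index a is the base point of the differences and b is the index whose
difference is eliminated. *)
pose a : 'I_k.+2 := ord0; pose b : 'I_k.+2 := lift ord0 ord0.
pose c (i : 'I_k) : 'I_k.+2 := lift ord0 (lift ord0 i).
have sumE (F : 'I_k.+2 -> int) : \sum_i F i = F a + (F b + \sum_i F (c i)).
  by rewrite !big_ord_recl.
pose g (x : 'cV[int]_k.+2) : {ffun 'I_k -> Zmod m} * Zmod (m * k.*2.+3) :=
  ([ffun i => piZ m (x (c i) 0 - x b 0)],
   piZ (m * k.*2.+3)%N (\sum_i x i 0 - k.*2.+3%:Z * x b 0)).
have g_add : zmod_morphism g.
  move=> x y; rewrite [RHS]surjective_pairing; congr (_, _) => /=.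
    apply/ffunP => i; rewrite !ffunE -piZB !mxE; congr piZ; ring.
  rewrite -piZB; congr piZ; rewrite !mxE.
  under eq_bigr do rewrite !mxE.
  rewrite sumrB; ring.
pose gA : {additive _ -> _} := HB.pack g (GRing.isZmodMorphism.Build _ _ g g_add).
(* The section is zero at b, so that the entries at the c i are lifts of the
first component; the entry at a then adjusts the total. *)
pose r (u : {ffun 'I_k -> Zmod m} * Zmod (m * k.*2.+3)) : 'cV[int]_k.+2 :=
  \col_i (if unlift ord0 i is Some j then
            if unlift ord0 j is Some l then reprZ _ (u.1 l) else 0
          else reprZ _ u.2 - \sum_l reprZ _ (u.1 l)).
have rE u : [/\ r u a 0 = reprZ _ u.2 - \sum_l reprZ _ (u.1 l),
    r u b 0 = 0 & forall l, r u (c l) 0 = reprZ _ (u.1 l)].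
  by rewrite !mxE !(unlift_none, liftK); split=> // l; rewrite mxE !liftK.
apply: (@coker_mx_isomorphic _ _ _ _ gA r) => [[u w]|x].
  have [ra rb rc] := rE (u, w).
  rewrite /= /g sumE ra rb mulr0 add0r subr0; congr (_, _).
    by apply/ffunP => i; rewrite ffunE rc subr0 piZK.
  by under [X in _ + X]eq_bigr do rewrite rc; rewrite subrK piZK.
have -> : (gA x == 0) = (g x == (0, 0)) by [].
rewrite xpair_eqE piZ_eq0; apply/andP/idP => [[/eqP/ffunP xc]|].
  move=> /dvdzP[t tE]; apply/mem_im_uniform_mx.
  have /fin_all_exists[y yE] i : exists y, x (c i) 0 = x b 0 + m%:Z * y.
    have := xc i; rewrite !ffunE => /eqP; rewrite piZ_eq0 => /dvdzP[y yE].
    by exists y; rewrite mulrC -yE addrC subrK.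
  (* The witness s of the image is x_b + m t: it is congruent to x_b, and the
  second component vanishing gives the sum. *)
  have sumx : \sum_i x i 0 = k.*2.+3%:Z * (x b 0 + m%:Z * t).
    by rewrite -[LHS](subrK (k.*2.+3%:Z * x b 0)) tE PoszM; ring.
  exists (x b 0 + m%:Z * t) => // i.
  apply/eqP; rewrite eqz_mod_dvd; apply/dvdzP.
  case: (unliftP ord0 i) => [j ->|->]; first case: (unliftP ord0 j) => [l ->|->].
  - by exists (y l - t); rewrite -/(c l) yE; ring.
  - by exists (- t); rewrite -/b; ring.
  (* At a the congruence follows from the others: x_a is the sum, which is
  (2 m + 1) s, minus the m other entries, each congruent to s. *)
  exists (x b 0 + (k.*2.+2)%:Z * t - \sum_i y i); rewrite -/a.
  move: sumx; rewrite sumE; under eq_bigr do rewrite yE.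
  rewrite big_split /= -mulr_sumr sumr_const card_ord -mulr_natl natz.
  have -> : (k.*2.+3)%:Z = 2 * k%:Z + 3 by lia.
  have -> : (k.*2.+2)%:Z = 2 * k%:Z + 2 by lia.
  have -> : m%:Z = k%:Z + 1 by lia.
  by move/(canRL (addrK _)) ->; ring.
case/mem_im_uniform_mx => s sumx xs; split.
  apply/eqP/ffunP => i; rewrite !ffunE; apply/eqP.
  by rewrite piZ_eq0 -eqz_mod_dvd !xs.
rewrite sumx -mulrBr mulnC PoszM dvdz_mul // -eqz_mod_dvd.
by rewrite xs.
Qed.
End UniformMatrix.

Local Close Scope quotient_scope.
Local Close Scope ring_scope.

Theorem proposition4p9 (n : nat) (V : finType) (q : V)
    (phi psi : signing (complete_graph V)) :
  3 <= n -> #|V| = n ->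
  negative_complete q psi -> switching_equivalent phi psi ->
  isomorphic (critical_group q phi)
    ({ffun 'I_(n - 3) -> Zmod (n - 2)} * Zmod ((n - 2) * (2 * n - 3)))%type.
Proof.
move=> n_ge3 cardV psiN /(critical_group_switching_equivalent q) phi_psi.
apply: isomorphic_trans phi_psi _.
rewrite /critical_group (reduced_laplacian_negative_complete psiN) cardsC1.
have [k nE] : exists k, n = k.+3 by exists (n - 3); lia.
rewrite cardV {}nE.
have -> : k.+3 - 3 = k by lia.
have -> : k.+3 - 2 = k.+1 by lia.
have -> : 2 * k.+3 - 3 = k.*2.+3 by lia.
exact: coker_uniform_mx.
Qed.
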